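(* Let $(\Omega,\Sigma,\mu)$ be a measure space, $X(\mu)$ an ideal function space with the $\sigma$-property, $E$ a Banach space, $p\in(0,\infty)$, and $T\colon X(\mu)\to E$ a linear operator which is $p$-th power factorable with an order-w continuous extension. Then $[i]\colon X(\mu)\to L^p(m_T)\cap L^1(m_T)$ is well defined, $T=I_{m_T}\circ[i]$, and $I_{m_T}\colon L^p(m_T)\cap L^1(m_T)\to E$ is $p$-th power factorable with an order-w continuous extension. Moreover the factorization is optimal: if $\xi$ is a measure on $\Sigma$ with $\xi\ll\mu$, $Z(\xi)$ is an ideal function space such that $[i]\colon X(\mu)\to Z(\xi)$ is well defined, and $S\colon Z(\xi)\to E$ is a linear operator with $T=S\circ[i]$ which is $p$-th power factorable with an order-w continuous extension, then $[i]\colon Z(\xi)\to L^p(m_T)\cap L^1(m_T)$ is well defined and $S=I_{m_T}\circ[i]$.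
   Context: $L^0(\lambda)$: $\lambda$-a.e. classes of $\Sigma$-measurable real functions. Ideal function space (i.f.s.) $Y(\lambda)\subset L^0(\lambda)$: vector subspace with $f\in Y(\lambda)$, $g\in L^0(\lambda)$, $|g|\le|f|$ a.e. $\Rightarrow g\in Y(\lambda)$. $\sigma$-property: $\Omega=\bigcup_n\Omega_n$, $\Omega_n\in\Sigma$, $\chi_{\Omega_n}\in X(\mu)$. For $q\in(0,\infty)$, $Y(\lambda)^q=\{f\in L^0(\lambda):|f|^q\in Y(\lambda)\}$; $Y(\lambda)+W(\lambda)=\{f=f_1+f_2\text{ a.e.}: f_1\in Y(\lambda),f_2\in W(\lambda)\}$. A linear operator $R$ on an i.f.s. is order-w continuous if $R(f_n)\to R(f)$ weakly whenever $0\le f_n\uparrow f$ a.e. within the space; $R\colon Y(\lambda)\to E$ is $p$-th power factorable with an order-w continuous extension if there is an order-w continuous linear $\tilde R\colon Y(\lambda)^{1/p}+Y(\lambda)\to E$ with $\tilde R=R$ on $Y(\lambda)$. For $\xi\ll\lambda$ (i.e. $\lambda(A)=0\Rightarrow\xi(A)=0$), $[i]$ maps the $\lambda$-class of $f$ to its $\xi$-class; ''$[i]\colon Y(\lambda)\to W(\xi)$ is well defined'' means $\xi\ll\lambda$ and the $\xi$-class of each $f\in Y(\lambda)$ lies in $W(\xi)$. $\Sigma_{X(\mu)}=\{A\in\Sigma:\chi_A\in X(\mu)\}$ ($\delta$-ring with local $\sigma$-algebra $\Sigma$), $m_T(A)=T(\chi_A)$ on $\Sigma_{X(\mu)}$ (a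 vector measure under the hypothesis). For a vector measure $m$ on $\Sigma_{X(\mu)}$: $|x^*m|$ the variation of $x^*\circ m$ on $\Sigma$, $\|m\|=\sup_{x^*\in B_{E^*}}|x^*m|$, $L^0(m)$ = $\Sigma$-measurable functions modulo $\|m\|$-null sets; $L^1(m)$ = those $f\in L^0(m)$ with $f\in L^1(|x^*m|)$ for all $x^*$ and, for each $A\in\Sigma$, some $\int_Af\,dm\in E$ with $x^*(\int_Af\,dm)=\int_Af\,dx^*m$ for all $x^*$; $I_m(f)=\int_\Omega f\,dm$; $L^p(m)=\{f\in L^0(m):|f|^p\in L^1(m)\}$. $L^p(m_T)\cap L^1(m_T)$ is regarded as an i.f.s. over a measure on $\Sigma$ having the same null sets as $\|m_T\|$. *)

(* Defs.v *)
From HB Require Import structures.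
From mathcomp Require Import all_boot all_order all_algebra.
From mathcomp Require Import all_classical all_reals all_analysis.
Set Implicit Arguments. Unset Strict Implicit. Unset Printing Implicit Defensive.
Import Order.TTheory GRing.Theory Num.Theory.
Import numFieldNormedType.Exports.
Local Open Scope classical_set_scope.
Local Open Scope ring_scope.

Section Defs.
Context {d : measure_display} {T : measurableType d} {R : realType}.

(* "Null-set structure": the paper's spaces only depend on the null sets of
   the underlying measure.  [N A] means A is a null set. *)
Definition mnull (lam : set T -> \bar R) : set T -> Prop :=
  fun A => measurable A /\ lam A = 0%E.

Definition ae (N : set T -> Prop) (P : T -> Prop) : Prop :=
  exists A, N A /\ [set w | ~ P w] `<=` A.

Definition abs_cont (Nxi Nlam : set T -> Prop) : Prop :=
  forall A, Nlam A -> Nxi A.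

(* Ideal function space over the null sets N: a set of (representatives of)
   measurable real functions which is a vector subspace and solid
   (hence closed under N-a.e. equality). *)
Definition ifs (N : set T -> Prop) (Y : set (T -> R)) : Prop :=
  [/\ forall f, Y f -> measurable_fun setT f,
      Y (fun _ => 0),
      forall f g, Y f -> Y g -> Y (f \+ g),
      forall (a : R) f, Y f -> Y (fun w => a * f w) &
      forall (f g : T -> R), Y f -> measurable_fun setT g ->
        ae N (fun w => `|g w| <= `|f w|) -> Y g].

Definition sigma_prop (X : set (T -> R)) : Prop :=
  exists Om : nat -> set T, (forall n, measurable (Om n)) /\
    \bigcup_n Om n = setT /\ (forall n, X (\1_(Om n) : T -> R)).

Definition ifs_pow (q : R) (Y : set (T -> R)) : set (T -> R) :=
  [set f : T -> R | measurable_fun setT f /\ Y (fun w => `|f w| `^ q)].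

Definition ifs_sum (N : set T -> Prop) (Y W : set (T -> R)) : set (T -> R) :=
  [set f : T -> R | measurable_fun setT f /\
    exists f1 f2, Y f1 /\ W f2 /\ ae N (fun w => f w = f1 w + f2 w)].

Definition incl_wd (Nlam Nxi : set T -> Prop) (Y W : set (T -> R)) : Prop :=
  abs_cont Nxi Nlam /\ (forall f, Y f -> W f).

Context {E : completeNormedModType R}.

Definition dualE (xs : E -> R) : Prop :=
  (forall (a : R) (u v : E), xs (a *: u + v) = a * xs u + xs v) /\
  continuous xs.

Definition dual_ball (xs : E -> R) : Prop :=
  dualE xs /\ (forall u : E, `|xs u| <= `|u|).

Definition op_on (N : set T -> Prop) (Y : set (T -> R)) (S : (T -> R) -> E)
  : Prop :=
  (forall f g, Y f -> Y g -> ae N (fun w => f w = g w) -> S f = S g) /\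
  (forall (a : R) f g, Y f -> Y g -> S (fun w => a * f w + g w) = a *: S f + S g).

Definition order_w_cont (N : set T -> Prop) (Y : set (T -> R))
  (S : (T -> R) -> E) : Prop :=
  forall (fs : nat -> T -> R) (f : T -> R), (forall n, Y (fs n)) -> Y f ->
    ae N (fun w => (forall n, 0 <= fs n w <= fs n.+1 w) /\
                   fs n w @[n --> \oo] --> f w) ->
    forall xs, dualE xs -> xs (S (fs n)) @[n --> \oo] --> xs (S f).

Definition pth_fact (p : R) (N : set T -> Prop) (Y : set (T -> R))
  (S : (T -> R) -> E) : Prop :=
  op_on N Y S /\
  exists St : (T -> R) -> E,
    op_on N (ifs_sum N (ifs_pow (p^-1) Y) Y) St /\
    order_w_cont N (ifs_sum N (ifs_pow (p^-1) Y) Y) St /\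
    (forall f, Y f -> St f = S f).

Definition SigmaX (X : set (T -> R)) : set (set T) :=
  [set A | measurable A /\ X (\1_A : T -> R)].

Definition mT (S : (T -> R) -> E) (A : set T) : E := S (\1_A : T -> R).

Section VM.
Variables (Sig : set (set T)) (m : set T -> E).

Definition varm (xs : E -> R) (A : set T) : \bar R :=
  ereal_sup [set r | exists (n : nat) (B : 'I_n -> set T),
      [/\ forall i, Sig (B i) /\ B i `<=` A,
          forall i j, i != j -> B i `&` B j = set0 &
          r = ((\sum_(i < n) `|xs (m (B i))|)%R)%:E]].

Definition pvar (xs : E -> R) (A : set T) : \bar R :=
  ereal_sup [set (xs (m B))%:E | B in [set B | Sig B /\ B `<=` A]].
Definition nvar (xs : E -> R) (A : set T) : \bar R :=
  ereal_sup [set (- xs (m B))%:E | B in [set B | Sig B /\ B `<=` A]].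

Definition sint (xs : E -> R) (A : set T) (f : T -> R) : \bar R :=
  (\int[pvar xs]_(w in A) (f w)%:E - \int[nvar xs]_(w in A) (f w)%:E)%E.

Definition semivar (A : set T) : \bar R :=
  ereal_sup [set varm xs A | xs in dual_ball].

Definition mnullm : set T -> Prop := mnull semivar.

Definition L1m : set (T -> R) :=
  [set f : T -> R | measurable_fun setT f /\
    (forall xs, dualE xs -> (varm xs).-integrable setT (EFin \o f)) /\
    (forall A, measurable A -> exists e : E,
       forall xs, dualE xs -> sint xs A f = (xs e)%:E)].

Definition Iint (f : T -> R) : E :=
  xget 0 [set e : E | forall xs, dualE xs -> sint xs setT f = (xs e)%:E].

Definition Lpm (p : R) : set (T -> R) :=
  [set f : T -> R | measurable_fun setT f /\ L1m (fun w => `|f w| `^ p)].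

End VM.
End Defs.

(* Main.v *)
(* Every integral here is weak, so all limits are taken after composing with a
   functional x*, and Hahn-Banach separation brings the conclusions back to E.

   Fix x* and let nu = x* o m_T on Sigma_X(mu).  Since the sets of Sigma_X(mu)
   cover Omega countably, local Hahn decompositions glue to a global Hahn set P,
   and |x* m_T| is the sum of the upper and lower variations of nu.  If S is an
   order-w continuous linear operator on a space Y stable under restriction to
   measurable sets, and S(chi_A) = m_T(A) on Sigma_X(mu), then for 0 <= f in Y
   monotone approximation by simple functions supported in Sigma_X(mu) gives
   x*(S(f chi_P)) = int f over the upper variation, which is therefore finite.
   Hence Y is contained in L^1(m_T) and S is the integration operator on Y.

   This applies to the extension of T on Y = X^{1/p} + X and to the extension of
   any competing S on Y = Z^{1/p} + Z.  As f in Z implies |f|^p in Z^{1/p}, it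
   yields both Z in L^1 and Z in L^p.  Conversely (L^p n L^1)^{1/p} + (L^p n L^1)
   is contained in L^1(m_T), where the integration operator is order-w continuous
   by dominated convergence. *)

Require Import Defs.
From HB Require Import structures.
From mathcomp Require Import all_boot all_order all_algebra.
From mathcomp Require Import all_classical all_reals all_analysis.
From mathcomp Require Import measurable_realfun ring.
Import Order.TTheory GRing.Theory Num.Theory.
Import numFieldNormedType.Exports.
Local Open Scope classical_set_scope.
Local Open Scope ring_scope.
Set Implicit Arguments.
Unset Strict Implicit.

(** * Separation of points by continuous functionals *)

Section Separation.
Context {R : realType} {E : normedModType R}.

(* A linear functional on a subspace is handled through its graph.  For a graph
   closed under linear combinations, domination by the norm forces
   single-valuedness. *)
Definition dominated_graph (G : set (E * R)) : Prop :=
  (forall a x y, G x -> G y -> G (a *: x.1 + y.1, a * x.2 + y.2)) /\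
  (forall x, G x -> x.2 <= `|x.1|).

(** The one-dimensional Hahn-Banach step. Domination at x + y and the triangle inequality put every
    number x.2 - |x.1 - v| below every number |y.1 + v| - y.2, so the supremum of the former is an
    admissible value c at v. *)
Lemma dominated_graph_extend (G : set (E * R)) (v : E) :
  dominated_graph G -> G !=set0 ->
  exists c, dominated_graph
    [set y | exists x t, G x /\ y = (x.1 + t *: v, x.2 + t * c)].
Proof.
move=> [Glin Gdom] [z0 Gz0].
have G0 : G (0, 0).
  by have := Glin (-1) _ _ Gz0 Gz0; rewrite scaleN1r mulN1r !addNr.
have GZ a x : G x -> G (a *: x.1, a * x.2).
  by move=> Gx; have := Glin a _ _ Gx G0; rewrite /= !addr0.
have sep x y : G x -> G y -> x.2 - `|x.1 - v| <= `|y.1 + v| - y.2.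
  move=> Gx Gy; rewrite lerBlDr -addrA [- y.2 + _]addrC addrA lerBrDr.
  have := Gdom _ (Glin 1 _ _ Gx Gy); rewrite /= scale1r mul1r => /le_trans; apply.
  have -> : x.1 + y.1 = (y.1 + v) + (x.1 - v).
    by rewrite addrACA [v - v]subrr addr0 addrC.
  exact: ler_normD.
pose A := [set x.2 - `|x.1 - v| | x in G].
have ubA y : G y -> ubound A (`|y.1 + v| - y.2) by move=> Gy _ [x Gx <-]; exact: sep.
have A0 : A !=set0 by exists (z0.2 - `|z0.1 - v|), z0.
have supA : has_sup A by split=> //; exists (`|z0.1 + v| - z0.2); exact: ubA.
pose c := sup A.
have c_ge x : G x -> x.2 - `|x.1 - v| <= c.
  by move=> Gx; apply: sup_upper_bound => //; exists x.
have c_le y : G y -> c <= `|y.1 + v| - y.2.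
  by move=> Gy; apply: ge_sup => //; exact: ubA.
exists c; split.
- move=> a _ _ [x [t [Gx ->]]] [y [s [Gy ->]]] /=.
  exists (a *: x.1 + y.1, a * x.2 + y.2), (a * t + s); split; first exact: Glin.
  congr pair => /=.
  + by rewrite scalerDr scalerDl scalerA addrACA.
  + by rewrite mulrDr mulrDl mulrA addrACA.
move=> _ [x [t [Gx ->]]] /=.
(* Dividing by |t| reduces t < 0 and t > 0 to t = -1 and t = 1, which are the lower and the upper
   bound on c. *)
have [t0|t0|->] := ltgtP t 0; last by rewrite scale0r mul0r !addr0; exact: Gdom.
- have s0 : 0 < - t by rewrite oppr_gt0.
  have := c_ge _ (GZ (- t)^-1 _ Gx); rewrite /= lerBlDr => h.
  have : (- t) * ((- t)^-1 * x.2) <= (- t) * (c + `|(- t)^-1 *: x.1 - v|).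
    by rewrite ler_pM2l.
  rewrite mulrA divff ?gt_eqF// mul1r mulrDr -[X in _ + X * _](gtr0_norm s0) -normrZ.
  rewrite scalerBr scalerA divff ?gt_eqF// scale1r scaleNr opprK mulNr.
  by rewrite addrC lerBrDr.
- have := c_le _ (GZ t^-1 _ Gx); rewrite /= lerBrDr => h.
  have : t * (c + t^-1 * x.2) <= t * `|t^-1 *: x.1 + v| by rewrite ler_pM2l.
  rewrite mulrDr mulrA divff ?gt_eqF// mul1r -[X in _ <= X * _](gtr0_norm t0) -normrZ.
  by rewrite scalerDr scalerA divff ?gt_eqF// scale1r addrC.
Qed.

(** A norming functional at u, obtained from a maximal dominated graph containing the line through
    (u, |u|). Maximality makes its domain all of E, since any missing v could be adjoined. *)
Lemma dominated_functional (u : E) : exists xs : E -> R,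
  [/\ forall (a : R) x y, xs (a *: x + y) = a * xs x + xs y,
      forall x, xs x <= `|x| & xs u = `|u| ].
Proof.
(* The guard [G !=set0] lets the empty graph, which is the union of the empty chain, satisfy [P]. *)
pose P G := dominated_graph G /\ (G !=set0 -> G (u, `|u|)).
have Pu : P [set (a *: u, a * `|u|) | a in setT].
  split; last by move=> _; exists 1 => //; rewrite scale1r mul1r.
  split=> [a _ _ [b _ <-] [c _ <-]|_ [a _ <-]] /=.
    by exists (a * b + c) => //; rewrite scalerDl mulrDl scalerA mulrA.
  by rewrite normrZ ler_wpM2r// ler_norm.
have [F FP Ftot|G [[Gd Gu'] Gmax]] := @Zorn_bigcup _ P.
  split; last first.
    move=> [x [A FA Ax]]; exists A => //.
    by apply: (FP A FA).2; exists x.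
  split=> [a x y [A FA Ax] [B FB By]|x [A FA Ax]]; last exact: (FP A FA).1.2.
  have [AB|BA] := Ftot _ _ FA FB.
    by exists B => //; apply: (FP B FB).1.1 => //; exact: AB.
  by exists A => //; apply: (FP A FA).1.1 => //; exact: BA.
have G0 : G !=set0.
  apply/set0P/eqP => G0; apply: Gmax Pu; rewrite G0.
  by split=> [z []|]; move=> /(_ (u, `|u|)); apply; exists 1;
     rewrite // scale1r mul1r.
have Gu := Gu' G0.
have [Glin Gdom] := Gd.
have Gtot v : exists r, G (v, r).
  apply: contrapT => nGv.
  have [c Hd] := dominated_graph_extend v Gd G0.
  pose H := [set y | exists x t, G x /\ y = (x.1 + t *: v, x.2 + t * c)].
  have GH : G `<=` H.
    by move=> x Gx; exists x, 0; rewrite scale0r mul0r !addr0 -surjective_pairing.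
  have [z Gz] := G0.
  have G00 : G (0, 0).
    by have := Glin (-1) _ _ Gz Gz; rewrite scaleN1r mulN1r !addNr.
  apply: (Gmax H); last by split => // _; exact: GH.
  split=> // HG; apply: nGv; exists c; apply: HG.
  by exists (0, 0), 1; rewrite scale1r mul1r !add0r.
have Guniq x r s : G (x, r) -> G (x, s) -> r = s.
  move=> Gr Gs; apply/eqP; rewrite eq_le; apply/andP; split.
    have := Gdom _ (Glin (-1) _ _ Gs Gr).
    by rewrite /= scaleN1r addNr normr0 mulN1r addrC subr_le0.
  have := Gdom _ (Glin (-1) _ _ Gr Gs).
  by rewrite /= scaleN1r addNr normr0 mulN1r addrC subr_le0.
pose xs v := projT1 (cid (Gtot v)).
have Gxs v : G (v, xs v) by rewrite /xs; case: cid.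
exists xs; split=> [a x y|x|].
- by apply: Guniq (Gxs _) _; exact: Glin (Gxs x) (Gxs y).
- exact: Gdom (Gxs x).
- exact: Guniq (Gxs u) Gu.
Qed.

End Separation.

(** * Bounds for continuous functionals and separation of points *)

Section Duality.
Context {R : realType} {E : completeNormedModType R}.

Lemma dualE0 (xs : E -> R) : dualE xs -> xs 0 = 0.
Proof.
by move=> [lin _]; have := lin (-1) 0 0; rewrite scaleN1r addNr mulN1r addNr.
Qed.

Lemma dualED (xs : E -> R) u v : dualE xs -> xs (u + v) = xs u + xs v.
Proof. by move=> [lin _]; have := lin 1 u v; rewrite scale1r mul1r. Qed.

Lemma dualEZ (xs : E -> R) a u : dualE xs -> xs (a *: u) = a * xs u.
Proof.
by move=> xsd; have [lin _] := xsd; have := lin a u 0; rewrite (dualE0 xsd) !addr0.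
Qed.

Lemma dualEN (xs : E -> R) : dualE xs -> dualE (fun u => - xs u).
Proof.
move=> [lin cont]; split=> [a u v|x]; first by rewrite lin opprD mulrN.
exact: continuousN (cont x).
Qed.

Lemma dualE_bounded (xs : E -> R) : dualE xs ->
  exists2 k, 0 < k & forall u, `|xs u| <= k * `|u|.
Proof.
move=> xsd; have [lin cont] := xsd.
have : \forall y \near (0 : E), `|xs y| < 1.
  have /cvgrPdist_lt/(_ 1 ltr01) := cont 0.
  by apply: filterS => y; rewrite (dualE0 xsd) sub0r normrN.
move=> /nbhs_ballP [e /= e0 he].
exists (2 / e) => [|u]; first by rewrite divr_gt0.
have [->|u0] := eqVneq u 0; first by rewrite (dualE0 xsd) !normr0 mulr0.
have nu : 0 < `|u| by rewrite normr_gt0.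
(* Scaling by s gives u the norm e / 2, inside the ball where |xs| < 1; this yields the constant 2 /
   e. *)
pose s := e / 2 / `|u|.
have s0 : 0 < s by rewrite !divr_gt0.
have /he : ball (0 : E) e (s *: u).
  rewrite -ball_normE /= sub0r normrN normrZ gtr0_norm// /s divfK ?gt_eqF//.
  by rewrite ltr_pdivrMr// ltr_pMr// ltr1n.
rewrite (dualEZ _ _ xsd) normrM gtr0_norm// mulrC -ltr_pdivlMr// => /ltW.
by rewrite div1r /s !invfM !invrK [_^-1 * 2]mulrC.
Qed.

(** The semivariation sees only [dual_ball]; this rescaling transfers what it says to every
    continuous functional. *)
Lemma dual_ball_scale (xs : E -> R) : dualE xs ->
  exists2 k, 0 < k & dual_ball (fun u => k * xs u).
Proof.
move=> xsd; have [k k0 hk] := dualE_bounded xsd; have [lin cont] := xsd.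
exists k^-1; first by rewrite invr_gt0.
split; last by move=> u; rewrite normrM gtr0_norm ?invr_gt0// ler_pdivrMl.
split=> [a u v|x]; first by rewrite lin mulrDr mulrCA.
exact: cvgM (cvg_cst _) (cont x).
Qed.

(** A norming functional at u - v does it. Its one-sided domination becomes two-sided by linearity,
    so it is 1-Lipschitz and hence continuous. *)
Lemma dual_separates (u v : E) : (forall xs, dualE xs -> xs u = xs v) -> u = v.
Proof.
move=> huv; have [xs [lin dom eqn]] := dominated_functional (u - v).
have xs0 : xs 0 = 0 by have := lin (-1) 0 0; rewrite scaleN1r addNr mulN1r addNr.
have xsN x : xs (- x) = - xs x.
  by have := lin (-1) x 0; rewrite !addr0 scaleN1r mulN1r xs0 addr0.
have xsB x y : xs (x - y) = xs x - xs y.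
  by have := lin 1 x (- y); rewrite scale1r mul1r xsN.
have bnd x : `|xs x| <= `|x|.
  by rewrite ler_norml dom andbT lerNl -xsN -[X in _ <= X]normrN dom.
have xsd : dualE xs.
  split=> // x; apply/cvgrPdist_lt => e e0.
  have /cvgrPdist_lt/(_ _ e0) := @cvg_id _ (nbhs x).
  by apply: filterS => y; apply: le_lt_trans; rewrite -xsB bnd.
apply/eqP; rewrite -subr_eq0 -normr_eq0 -eqn xsB subr_eq0; apply/eqP.
exact: huv.
Qed.

End Duality.

(** * Signed measures on a hereditary ring of sets *)

Section DeltaIdeal.
Context {d : measure_display} {T : measurableType d} {R : realType}.

(* The properties of [SigmaX X] that are used when X has the sigma-property: it
   is hereditary, which a general delta-ring with local sigma-algebra is not. *)
Definition delta_ideal (Sig : set (set T)) : Prop :=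
  [/\ forall A, Sig A -> measurable A,
      forall A B, Sig A -> measurable B -> B `<=` A -> Sig B,
      forall A B, Sig A -> Sig B -> Sig (A `|` B) &
      exists D : nat -> set T, (forall n, Sig (D n)) /\ \bigcup_n D n = setT].

(** Countable additivity, written as finite additivity with continuity from below. In this form it
    can be read off from linearity and order-w continuity of an operator. *)
Definition signed_measure_on (Sig : set (set T)) (nu : set T -> R) : Prop :=
  (forall A B, Sig A -> Sig B -> A `&` B = set0 -> nu (A `|` B) = nu A + nu B) /\
  (forall A : nat -> set T, (forall n, Sig (A n)) ->
    (forall n, A n `<=` A n.+1) -> Sig (\bigcup_n A n) ->
    nu (A n) @[n --> \oo] --> nu (\bigcup_n A n)).

Lemma signed_measure_onN Sig nu :
  signed_measure_on Sig nu -> signed_measure_on Sig (fun A => - nu A).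
Proof.
move=> [nuU nuc]; split=> [A B SA SB AB|A SA Am SU].
  by rewrite nuU// opprD.
by apply: cvgN; exact: nuc.
Qed.

Lemma bigsetU_disjoint (F : nat -> set T) n : trivIset setT F ->
  (\big[setU/set0]_(i < n) F i) `&` F n = set0.
Proof.
move=> tF; rewrite -bigcup_mkord setI_bigcupl bigcup0// => i /= i_n.
apply: contrapT => /eqP/set0P iF; have E : i = n by exact: (tF i n).
by rewrite E ltnn in i_n.
Qed.

Section SignedMeasure.
Context {Sig : set (set T)} {nu : set T -> R}.
Context (SigI : delta_ideal Sig) (nuM : signed_measure_on Sig nu).

Lemma delta_ideal_measurable A : Sig A -> measurable A.
Proof. by case: SigI => h _ _ _; exact: h. Qed.

Lemma delta_idealW A B : Sig A -> measurable B -> B `<=` A -> Sig B.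
Proof. by case: SigI => _ h _ _; exact: h. Qed.

Lemma delta_idealI A B : Sig A -> measurable B -> Sig (A `&` B).
Proof.
move=> SA mB; apply: (delta_idealW SA); last exact: subIsetl.
exact: measurableI (delta_ideal_measurable SA) mB.
Qed.

Lemma delta_idealU A B : Sig A -> Sig B -> Sig (A `|` B).
Proof. by case: SigI => _ _ h _; exact: h. Qed.

Lemma delta_ideal0 : Sig set0.
Proof. by case: SigI => _ _ _ [D [SD _]]; exact: (delta_idealW (SD 0%N)). Qed.

Lemma delta_ideal_bigsetU (F : nat -> set T) n :
  (forall i, Sig (F i)) -> Sig (\big[setU/set0]_(i < n) F i).
Proof.
by move=> SF; elim/big_ind : _ => //; [exact: delta_ideal0|exact: delta_idealU].
Qed.

Lemma signed_measure0 : nu set0 = 0.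
Proof.
have := nuM.1 set0 set0 delta_ideal0 delta_ideal0 (set0I _).
by rewrite setU0 => /eqP; rewrite -subr_eq subrr eq_sym => /eqP.
Qed.

Lemma signed_measureID A P : Sig A -> measurable P ->
  nu A = nu (A `&` P) + nu (A `&` ~` P).
Proof.
move=> SA mP; rewrite -nuM.1 ?setUIDK//.
- exact: delta_idealI.
- by apply: delta_idealI => //; exact: measurableC.
- by rewrite setIACA setICr setI0.
Qed.

Lemma signed_measure_bigsetU B (F : nat -> set T) n : Sig B ->
  (forall i, measurable (F i)) -> trivIset setT F ->
  nu (B `&` \big[setU/set0]_(i < n) F i) = \sum_(i < n) nu (B `&` F i).
Proof.
move=> SB mF tF; elim: n => [|n IHn].
  by rewrite !big_ord0 setI0 signed_measure0.
rewrite !big_ord_recr/= setIUr nuM.1 ?IHn//.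
- by apply: delta_idealI => //; exact: bigsetU_measurable.
- exact: delta_idealI.
- by rewrite setIACA bigsetU_disjoint// setI0.
Qed.

Lemma signed_measure_cvg_bigsetU B (F : nat -> set T) : Sig B ->
  (forall i, measurable (F i)) -> B `<=` \bigcup_n F n ->
  nu (B `&` \big[setU/set0]_(i < n) F i) @[n --> \oo] --> nu B.
Proof.
move=> SB mF BF.
have E : B = \bigcup_n (B `&` \big[setU/set0]_(i < n) F i).
  apply/seteqP; split=> [x Bx|x [n _ []]//].
  have [n _ Fx] := BF _ Bx; exists n.+1 => //; split=> //.
  by rewrite -bigcup_mkord; exists n => /=.
rewrite {2}E; apply: nuM.2; last by rewrite -E.
  by move=> n; apply: delta_idealI => //; exact: bigsetU_measurable.
by move=> n; apply: setIS; rewrite big_ord_recr/=; exact: subsetUl.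
Qed.

Lemma signed_measure_sum_cvg B (F : nat -> set T) : Sig B ->
  (forall i, measurable (F i)) -> trivIset setT F -> B `<=` \bigcup_n F n ->
  \sum_(i < n) nu (B `&` F i) @[n --> \oo] --> nu B.
Proof.
move=> SB mF tF BF.
under eq_cvg do rewrite -signed_measure_bigsetU//.
exact: signed_measure_cvg_bigsetU.
Qed.

(** Cutting by a set of [Sig] turns [nu] into a finite charge on the whole sigma-algebra, to which
    the classical Hahn decomposition applies. *)
Lemma restr_charge D : Sig D ->
  exists c : {charge set T -> \bar R}, forall A, c A = (nu (D `&` A))%:E.
Proof.
move=> SD; pose f A : \bar R := (nu (D `&` A))%:E.
have f0 : f set0 = 0%E by rewrite /f setI0 signed_measure0.
have ff A : measurable A -> f A \is a fin_num by [].
have fs : semi_sigma_additive f.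
  move=> F mF tF mU.
  under eq_cvg do rewrite big_mkord sumEFin.
  apply: cvg_EFin; first exact: nearW.
  have := @signed_measure_sum_cvg (D `&` \bigcup_n F n) F
    (delta_idealI SD mU) mF tF (@subIsetr _ _ _).
  apply: cvg_trans; apply: near_eq_cvg; apply: nearW => n /=.
  apply: eq_bigr => i _; congr (nu _); rewrite -setIA; congr setI.
  by apply/setIidPr; exact: bigcup_sup.
exists (HB.pack_for (charge T R) f (isCharge.Build d T R f f0 ff fs)).
by [].
Qed.

(** The cover by sets of [Sig] is made disjoint and the Hahn sets of its pieces are united. For B
    inside P or its complement, nu B is the limit of the sums of nu (B [&] F i), whose terms all
    have the required sign. *)
Lemma signed_measure_Hahn : exists P, [/\ measurable P,
  forall B, Sig B -> B `<=` P -> 0 <= nu B &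
  forall B, Sig B -> B `<=` ~` P -> nu B <= 0].
Proof.
have [D [SD DT]] : exists D : nat -> set T, (forall n, Sig (D n)) /\ \bigcup_n D n = setT.
  by case: SigI.
have H n : exists Q, [/\ measurable Q,
    forall B, Sig B -> B `<=` D n `&` Q -> 0 <= nu B &
    forall B, Sig B -> B `<=` D n `&` ~` Q -> nu B <= 0].
  have [c cE] := restr_charge (SD n).
  have [P [N [[mP posP] [mN negN] PN _]]] := Hahn_decomposition c.
  exists P; split=> // B SB.
    rewrite subsetI => -[BD BP].
    have := posP B (delta_ideal_measurable SB) BP.
    by rewrite cE lee_fin; move/setIidPr: BD => ->.
  rewrite subsetI => -[BD BP].
  have BN : B `<=` N.
    move=> x Bx; have : (P `|` N) x by rewrite PN.
    by case=> // /(BP _ Bx).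
  have := negN B (delta_ideal_measurable SB) BN.
  by rewrite cE lee_fin; move/setIidPr: BD => ->.
pose Q n := projT1 (cid (H n)).
have QP n : [/\ measurable (Q n),
    forall B, Sig B -> B `<=` D n `&` Q n -> 0 <= nu B &
    forall B, Sig B -> B `<=` D n `&` ~` Q n -> nu B <= 0].
  by rewrite /Q; case: cid.
pose F := seqDU D.
have mF n : measurable (F n).
  by apply: seqDU_measurable => k; exact: delta_ideal_measurable.
have tF : trivIset setT F by exact: trivIset_seqDU.
have FD n : F n `<=` D n by exact: subset_seqDU.
have FT B : B `<=` \bigcup_n F n by rewrite -seqDU_bigcup_eq DT.
pose P := \bigcup_n (F n `&` Q n).
have mQ n : measurable (Q n) by case: (QP n).
have mP : measurable P.
  by apply: bigcup_measurable => n _; exact: measurableI.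
exists P; split=> // B SB BP.
- have := signed_measure_sum_cvg SB mF tF (@FT B) => nuc.
  rewrite -(cvg_lim _ nuc)//; apply: limr_ge; first by apply/cvg_ex; eexists; exact: nuc.
  apply: nearW => n; apply: sumr_ge0 => i _.
  have [_ + _] := QP i; apply; first exact: delta_idealI.
  move=> x [Bx Fx]; split; first exact: FD.
  have [j _ [Fjx Qjx]] := BP _ Bx.
  suff -> : nat_of_ord i = j by [].
  by apply: (tF i j) => //; exists x.
- have := signed_measure_sum_cvg SB mF tF (@FT B) => nuc.
  rewrite -(cvg_lim _ nuc)//; apply: limr_le; first by apply/cvg_ex; eexists; exact: nuc.
  apply: nearW => n; apply: sumr_le0 => i _.
  have [_ _ +] := QP i; apply; first exact: delta_idealI.
  move=> x [Bx Fx]; split; first exact: FD.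
  by move=> Qx; apply: (BP _ Bx); exists i.
Qed.

End SignedMeasure.
End DeltaIdeal.

(** The two suprema are taken one after the other. Moving the second across the inequality needs it
    finite: -oo is excluded because B is nonempty, and +oo forces c = +oo. *)
Lemma ereal_sup_image_add {R : realType} (I J : Type) (A : set I) (B : set J)
    (f : I -> R) (g : J -> R) (c : \bar R) : A !=set0 -> B !=set0 ->
  (forall i j, A i -> B j -> ((f i + g j)%:E <= c)%E) ->
  (ereal_sup [set (f i)%:E | i in A] + ereal_sup [set (g j)%:E | j in B] <= c)%E.
Proof.
move=> [i0 Ai0] [j0 Bj0] fgc.
set sg := ereal_sup [set (g j)%:E | j in B].
have sg_le i : A i -> ((f i)%:E + sg <= c)%E.
  move=> Ai; rewrite addeC -leeBrDr//; apply: ge_ereal_sup => _ [j Bj <-].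
  by rewrite leeBrDr// -EFinD addrC; exact: fgc.
have : ((g j0)%:E <= sg)%E by apply: ereal_sup_ubound; exists j0.
move: sg_le; case: sg => [r| |]//= sg_le _.
  rewrite -leeBrDr//; apply: ge_ereal_sup => _ [i Ai <-].
  by rewrite leeBrDr//; exact: sg_le.
by have := sg_le _ Ai0; rewrite addey// => /(le_trans _); apply; rewrite leey.
Qed.

(** * Upper, lower and total variation, and the Jordan decomposition *)

Section Variations.
Context {d : measure_display} {T : measurableType d} {R : realType}.
Context {E : completeNormedModType R}.

(** Facts about upper variations pass to lower ones by changing the sign of the functional. *)
Lemma nvarE Sig (m : set T -> E) (xs : E -> R) :
  nvar Sig m xs = pvar Sig m (fun u => - xs u).
Proof. by []. Qed.

Section Fixed.
Context {Sig : set (set T)} {m : set T -> E} {xs : E -> R}.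
Context (SigI : delta_ideal Sig) (nuM : signed_measure_on Sig (fun A => xs (m A))).
Local Notation pv := (pvar Sig m xs).
Local Notation nv := (nvar Sig m xs).

Lemma pvar_ge A B : Sig B -> B `<=` A -> ((xs (m B))%:E <= pv A)%E.
Proof. by move=> SB BA; apply: ereal_sup_ubound; exists B. Qed.

Lemma nvar_ge A B : Sig B -> B `<=` A -> ((- xs (m B))%:E <= nv A)%E.
Proof. by move=> SB BA; apply: ereal_sup_ubound; exists B. Qed.

Lemma pvar_le A c :
  (forall B, Sig B -> B `<=` A -> ((xs (m B))%:E <= c)%E) -> (pv A <= c)%E.
Proof. by move=> h; apply: ge_ereal_sup => _ [B [SB BA] <-]; exact: h. Qed.

Lemma nvar_le A c :
  (forall B, Sig B -> B `<=` A -> ((- xs (m B))%:E <= c)%E) -> (nv A <= c)%E.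
Proof. by move=> h; apply: ge_ereal_sup => _ [B [SB BA] <-]; exact: h. Qed.

Lemma pvar_ge0 A : (0 <= pv A)%E.
Proof.
rewrite -[X in (X%:E <= _)%E](signed_measure0 SigI nuM).
by apply: pvar_ge; [exact: delta_ideal0 SigI|exact: sub0set].
Qed.

Lemma pvar0 : pv set0 = 0%E.
Proof.
apply/eqP; rewrite eq_le pvar_ge0 andbT; apply: pvar_le => B _.
by rewrite subset0 => ->; rewrite lee_fin (signed_measure0 SigI nuM).
Qed.

Lemma pvar_subset A B : A `<=` B -> (pv A <= pv B)%E.
Proof.
by move=> AB; apply: pvar_le => C SC CA; apply: pvar_ge => //; exact: subset_trans AB.
Qed.

Lemma pvar_superadditive A B : A `&` B = set0 -> (pv A + pv B <= pv (A `|` B))%E.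
Proof.
move=> AB.
have S0 C : [set D | Sig D /\ D `<=` C] !=set0.
  by exists set0; split; [exact: delta_ideal0 SigI|exact: sub0set].
apply: ereal_sup_image_add => // C D [SC CA] [SD DB].
rewrite -nuM.1//; last by apply/seteqP; split=> // x [/CA ? /DB ?]; rewrite -AB.
by apply: pvar_ge; [exact: delta_idealU SigI _ _ SC SD|exact: setUSS].
Qed.

Lemma pvar_sum_le n (F : nat -> set T) : trivIset setT F ->
  (\sum_(i < n) pv (F i) <= pv (\big[setU/set0]_(i < n) F i))%E.
Proof.
move=> tF; elim: n => [|n IHn]; first by rewrite !big_ord0 pvar_ge0.
rewrite !big_ord_recr/= (le_trans _ (pvar_superadditive _))//.
  exact: leeD2r.
exact: bigsetU_disjoint.
Qed.

(** Integrals against the bare set function [pv] become accessible through a genuine measure equal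
    to it. Splitting a set of [Sig] along the partition gives countable subadditivity;
    superadditivity and monotonicity give the converse. *)
Lemma pvar_measure : exists P : {measure set T -> \bar R}, P = pv :> (set T -> \bar R).
Proof.
have pvs : semi_sigma_additive pv.
  move=> F mF tF mU.
  suff -> : pv (\bigcup_n F n) = (\sum_(0 <= i <oo) pv (F i))%E.
    by apply: is_cvg_nneseries => i _ _; exact: pvar_ge0.
  apply/eqP; rewrite eq_le; apply/andP; split.
    apply: pvar_le => B SB BF.
    have h := signed_measure_sum_cvg SigI nuM SB mF tF BF.
    have {h} : (\sum_(i < n) xs (m (B `&` F i)))%:E @[n --> \oo] --> (xs (m B))%:E.
      by apply: cvg_EFin; first exact: nearW.
    move=> h; rewrite -(cvg_lim _ h)//; apply: lime_le.
      by apply/cvg_ex; eexists; exact: h.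
    apply: nearW => n; rewrite -sumEFin.
    apply: le_trans (nneseries_lim_ge n _); last by move=> i _ _; exact: pvar_ge0.
    rewrite big_mkord; apply: lee_sum => i _.
    by apply: pvar_ge; [exact: delta_idealI SigI _ _ SB (mF i)|exact: subIsetr].
  apply: lime_le; first by apply: is_cvg_nneseries => i _ _; exact: pvar_ge0.
  apply: nearW => n; rewrite big_mkord; apply: le_trans (pvar_sum_le _ tF) _.
  by apply: pvar_subset; rewrite -bigcup_mkord; exact: bigcup_subset.
exists (HB.pack_for (measure T R) pv (isMeasure.Build d T R pv pvar0 pvar_ge0 pvs)).
by [].
Qed.

End Fixed.

Section Jordan.
Context {Sig : set (set T)} {m : set T -> E} {xs : E -> R}.
Context (SigI : delta_ideal Sig) (nuM : signed_measure_on Sig (fun A => xs (m A))).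
Context (P : set T) (mP : measurable P)
  (Ppos : forall B, Sig B -> B `<=` P -> 0 <= xs (m B))
  (Pneg : forall B, Sig B -> B `<=` ~` P -> xs (m B) <= 0).
Local Notation pv := (pvar Sig m xs).
Local Notation nv := (nvar Sig m xs).

(** The supremum is attained at A [&] P: discarding the part of B outside P, then adding the rest of
    A [&] P, can only increase the value. *)
Lemma pvar_Hahn A : Sig A -> pv A = (xs (m (A `&` P)))%:E.
Proof.
move=> SA; have SAP := delta_idealI SigI SA mP.
apply/eqP; rewrite eq_le pvar_ge ?andbT//.
apply: pvar_le => B SB BA; rewrite lee_fin.
rewrite (signed_measureID SigI nuM SB mP).
rewrite (signed_measureID SigI nuM SAP (delta_ideal_measurable SigI SB)).
have -> : A `&` P `&` B = B `&` P by rewrite setIAC (setIidr BA).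
rewrite lerD2l (le_trans (Pneg _ _))//.
- by apply: (delta_idealI SigI) => //; exact: measurableC.
- apply: Ppos; last by move=> x [[]].
  apply: (delta_idealI SigI) => //; apply: measurableC.
  exact: delta_ideal_measurable SigI _ SB.
Qed.

Lemma nvar_Hahn A : Sig A -> nv A = (- xs (m (A `&` ~` P)))%:E.
Proof.
move=> SA; have SAP := delta_idealI SigI SA (measurableC mP).
apply/eqP; rewrite eq_le nvar_ge ?andbT//.
apply: nvar_le => B SB BA; rewrite lee_fin lerN2.
rewrite (signed_measureID SigI nuM SB mP).
rewrite (signed_measureID SigI nuM SAP (delta_ideal_measurable SigI SB)).
have -> : A `&` ~` P `&` B = B `&` ~` P by rewrite setIAC (setIidr BA).
rewrite addrC lerD2r (le_trans _ (Ppos _ _))//.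
- apply: Pneg; last by move=> x [[]].
  apply: (delta_idealI SigI) => //; apply: measurableC.
  exact: delta_ideal_measurable SigI _ SB.
- exact: delta_idealI SigI _ _ SB mP.
Qed.

End Jordan.

Section Total.
Context {Sig : set (set T)} {m : set T -> E} {xs : E -> R}.
Context (SigI : delta_ideal Sig) (nuM : signed_measure_on Sig (fun A => xs (m A))).
Local Notation pv := (pvar Sig m xs).
Local Notation nv := (nvar Sig m xs).

Lemma varm_pair A B C : Sig B -> Sig C -> B `<=` A -> C `<=` A -> B `&` C = set0 ->
  ((`|xs (m B)| + `|xs (m C)|)%:E <= varm Sig m xs A)%E.
Proof.
move=> SB SC BA CA BC; apply: ereal_sup_ubound.
exists 2%N, (fun i : 'I_2 => if i == ord0 then B else C); split.
- by move=> i; case: ifP.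
- by move=> [[|[|]]//= ?] [[|[|]]//= ?] //= _; rewrite setIC.
- by rewrite big_ord_recl big_ord1.
Qed.

Lemma varm_decomp : varm Sig m xs = (fun A => pv A + nv A)%E.
Proof.
have [P [mP Ppos Pneg]] := signed_measure_Hahn SigI nuM.
have nuMN := signed_measure_onN nuM.
apply/funext => A; apply/eqP; rewrite eq_le; apply/andP; split.
  apply: ge_ereal_sup => _ [n [B [SB BB ->]]].
  (* The family indexed by ['I_n] is continued by empty sets to a disjoint sequence. *)
  pose F k := if insub k is Some i then B i else set0.
  have FE (i : 'I_n) : F i = B i by rewrite /F valK.
  have tF : trivIset setT F.
    move=> i j _ _ [x []]; rewrite /F.
    case: insubP => [i' _ <-|_]; last by [].
    case: insubP => [j' _ <- Bi Bj|_]; last by [].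
    congr nat_of_ord; apply: contrapT => /eqP /BB ij.
    by have : (B i' `&` B j') x by []; rewrite ij.
  have UA : \big[setU/set0]_(i < n) F i `<=` A.
    rewrite -bigcup_mkord; apply: bigcup_sub => i /= i_n.
    by rewrite -[i]/(nat_of_ord (Ordinal i_n)) FE; case: (SB (Ordinal i_n)).
  apply: (@le_trans _ _ (\sum_(i < n) pv (F i) + \sum_(i < n) nv (F i))%E); last first.
    apply: leeD.
      exact: le_trans (pvar_sum_le SigI nuM _ tF) (pvar_subset UA).
    rewrite nvarE.
    exact: le_trans (pvar_sum_le SigI nuMN _ tF) (pvar_subset UA).
  rewrite -big_split/= -sumEFin; apply: lee_sum => i _; rewrite FE.
  have SBi := (SB i).1.
  rewrite (pvar_Hahn SigI nuM mP Ppos Pneg)// (nvar_Hahn SigI nuM mP Ppos Pneg)//.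
  rewrite -EFinD lee_fin (signed_measureID SigI nuM SBi mP).
  rewrite (le_trans (ler_normD _ _))// ger0_norm ?ler0_norm//.
    by apply: Pneg; [exact: delta_idealI SigI _ _ SBi (measurableC mP)|exact: subIsetr].
  by apply: Ppos; [exact: delta_idealI SigI _ _ SBi mP|exact: subIsetr].
have S0 C : [set D | Sig D /\ D `<=` C] !=set0.
  by exists set0; split; [exact: delta_ideal0 SigI|exact: sub0set].
apply: ereal_sup_image_add => // B C [SB BA] [SC CA].
have SBP := delta_idealI SigI SB mP.
have SCP := delta_idealI SigI SC (measurableC mP).
apply: le_trans (varm_pair (A := A) SBP SCP _ _ _); last first.
- by rewrite setIACA setICr setI0.
- by move=> x [/CA].
- by move=> x [/BA].
rewrite lee_fin lerD//.
  rewrite (signed_measureID SigI nuM SB mP) -[leRHS]addr0 lerD ?ler_norm//.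
  by apply: Pneg; [exact: delta_idealI SigI _ _ SB (measurableC mP)|exact: subIsetr].
rewrite -normrN (signed_measureID SigI nuM SC mP) opprD -[leRHS]add0r lerD ?ler_norm//.
by rewrite oppr_le0; apply: Ppos; [exact: delta_idealI SigI _ _ SC mP|exact: subIsetr].
Qed.

Lemma jordan_measures : exists Pm Nm : {measure set T -> \bar R},
  [/\ Pm = pv :> (set T -> \bar R), Nm = nv :> (set T -> \bar R) &
      measure_add Pm Nm = varm Sig m xs :> (set T -> \bar R)].
Proof.
have [Pm PmE] := pvar_measure SigI nuM.
have [Nm NmE] := @pvar_measure Sig m (fun u => - xs u) SigI (signed_measure_onN nuM).
exists Pm, Nm; split=> //.
by rewrite varm_decomp nvarE -PmE -NmE; apply/funext => A; rewrite measure_addE.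
Qed.

End Total.
End Variations.

(** * Weak integration *)

Section WeakIntegral.
Context {d : measure_display} {T : measurableType d} {R : realType}.

Lemma ae_measure (N : set T -> Prop) (mu : {measure set T -> \bar R}) (Q : T -> Prop) :
  (forall A, N A -> measurable A /\ mu A = 0%E) -> ae N Q ->
  {ae mu, forall w, Q w}.
Proof.
move=> Nmu [A [NA QA]]; have [mA A0] := Nmu _ NA.
by exists A; split.
Qed.

Lemma integrable_measure_add (m1 m2 : {measure set T -> \bar R}) (f : T -> \bar R) :
  (measure_add m1 m2).-integrable setT f <->
  m1.-integrable setT f /\ m2.-integrable setT f.
Proof.
have E : measurable_fun setT f -> (\int[measure_add m1 m2]_x `|f x| =
    \int[m1]_x `|f x| + \int[m2]_x `|f x|)%E.
  by move=> mf; rewrite ge0_integral_measure_add//; exact: measurableT_comp.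
split=> [/integrableP[mf]|[/integrableP[mf h1] /integrableP[_ h2]]].
  rewrite E// => h; split; apply/integrableP; split=> //; apply: le_lt_trans h.
    by rewrite leeDl// integral_ge0.
  by rewrite leeDr// integral_ge0.
by apply/integrableP; split=> //; rewrite E// lte_add_pinfty.
Qed.

Lemma integral_linear (mu : {measure set T -> \bar R}) A (a : R) (f g : T -> R) :
  measurable A -> mu.-integrable A (EFin \o f) -> mu.-integrable A (EFin \o g) ->
  (\int[mu]_(w in A) (a * f w + g w)%:E =
   a%:E * \int[mu]_(w in A) (f w)%:E + \int[mu]_(w in A) (g w)%:E)%E.
Proof.
move=> mA fi gi; under eq_integral do rewrite EFinD EFinM.
rewrite integralD//; last exact: integrableZl.
by rewrite integralZl.
Qed.

Context {E : completeNormedModType R}.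

(** Countable additivity tested by functionals. When [Sig] is a [delta_ideal], the Orlicz-Pettis
    theorem makes it equivalent to countable additivity in norm. *)
Definition weak_vector_measure (Sig : set (set T)) (m : set T -> E) : Prop :=
  forall xs : E -> R, dualE xs -> signed_measure_on Sig (fun A => xs (m A)).

Context {Sig : set (set T)} {m : set T -> E}.
Context (SigI : delta_ideal Sig) (mM : weak_vector_measure Sig m).

Lemma weak_vector_measure0 : m set0 = 0.
Proof.
apply: dual_separates => xs xsd.
by rewrite (signed_measure0 SigI (mM xsd)) dualE0.
Qed.

(** This trades the semivariation for values of [m], the form in which null sets are compared later.
    One direction scales a functional into the dual ball and then separates points. *)
Lemma mnullmP A : mnullm Sig m A <->
  measurable A /\ forall B, Sig B -> B `<=` A -> m B = 0.
Proof.
split=> [[mA A0]|[mA A0]]; split=> //.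
  move=> B SB BA; apply: dual_separates => xs xsd; rewrite (dualE0 xsd).
  have [k k0 kxs] := dual_ball_scale xsd.
  have : ((`|k * xs (m B)| + `|k * xs (m set0)|)%:E <= semivar Sig m A)%E.
    apply: (le_trans (@varm_pair _ _ _ _ Sig m (fun u => k * xs u) A B set0 _ _ _ _ _)) => //.
    - exact: delta_ideal0 SigI.
    - by rewrite setI0.
    - by apply: ereal_sup_ubound; exists (fun u => k * xs u).
  rewrite A0 weak_vector_measure0 (dualE0 xsd) mulr0 normr0 addr0 lee_fin normr_le0.
  by rewrite mulf_eq0 gt_eqF//= => /eqP.
apply/eqP; rewrite eq_le; apply/andP; split.
  apply: ge_ereal_sup => _ [xs [xsd _] <-]; apply: ge_ereal_sup => _ [n [B [SB _ ->]]].
  rewrite lee_fin big1// => i _; have [SBi BA] := SB i.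
  by rewrite A0// (dualE0 xsd) normr0.
(* Nonnegativity of the semivariation is witnessed by the zero functional and the empty family. *)
apply: (@le_trans _ _ (varm Sig m (fun=> 0) A)).
  apply: ereal_sup_ubound; exists 0%N, (fun=> set0); split; try by case.
  by rewrite big_ord0.
apply: ereal_sup_ubound; exists (fun=> 0) => //; split; last by move=> u; rewrite normr0.
split=> [a u v|]; first by rewrite mulr0 addr0.
exact: cst_continuous.
Qed.

Lemma mnullm_pvar xs A : dualE xs -> mnullm Sig m A -> pvar Sig m xs A = 0%E.
Proof.
move=> xsd /mnullmP[mA A0]; apply/eqP.
rewrite eq_le (pvar_ge0 SigI (mM xsd)) andbT; apply: pvar_le => B SB BA.
by rewrite A0// (dualE0 xsd).
Qed.

Lemma jordan_measures_null xs : dualE xs -> exists P N : {measure set T -> \bar R},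
  [/\ P = pvar Sig m xs :> (set T -> \bar R), N = nvar Sig m xs :> (set T -> \bar R),
      measure_add P N = varm Sig m xs :> (set T -> \bar R),
      (forall A, mnullm Sig m A -> measurable A /\ P A = 0%E) &
      (forall A, mnullm Sig m A -> measurable A /\ N A = 0%E)].
Proof.
move=> xsd; have [P [N [PE NE VE]]] := jordan_measures SigI (mM xsd).
exists P, N; split=> // A A0; (split; first by case: A0).
  by rewrite PE mnullm_pvar.
by rewrite NE nvarE mnullm_pvar//; exact: dualEN.
Qed.

Lemma varm_integrable_linear xs a f g : dualE xs ->
  (varm Sig m xs).-integrable setT (EFin \o f) ->
  (varm Sig m xs).-integrable setT (EFin \o g) ->
  (varm Sig m xs).-integrable setT (EFin \o (fun w => a * f w + g w)).
Proof.
move=> xsd; have [P [N [_ _ <- _ _]]] := jordan_measures_null xsd => fi gi.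
have := integrableD measurableT (integrableZl measurableT a fi) gi.
exact.
Qed.

Lemma sint_linear xs A a f g : dualE xs ->
  (varm Sig m xs).-integrable setT (EFin \o f) ->
  (varm Sig m xs).-integrable setT (EFin \o g) -> measurable A ->
  (sint Sig m xs A (fun w => (a * f w + g w)%R) =
   a%:E * sint Sig m xs A f + sint Sig m xs A g)%E.
Proof.
move=> xsd + + mA; have [P [N [PE NE <- _ _]]] := jordan_measures_null xsd.
move=> /integrable_measure_add[Pf Nf] /integrable_measure_add[Pg Ng].
have sA (Q : {measure set T -> \bar R}) h :
    Q.-integrable setT h -> Q.-integrable A h by exact: integrableS.
rewrite /sint -PE -NE !integral_linear//; try exact: sA.
rewrite -(fineK (integrable_fin_num mA (sA _ _ Pf))).
rewrite -(fineK (integrable_fin_num mA (sA _ _ Nf))).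
rewrite -(fineK (integrable_fin_num mA (sA _ _ Pg))).
rewrite -(fineK (integrable_fin_num mA (sA _ _ Ng))).
by rewrite -!EFinM -!EFinN -!EFinD; congr EFin; ring.
Qed.

Lemma L1m_linear a f g : L1m Sig m f -> L1m Sig m g ->
  L1m Sig m (fun w => a * f w + g w).
Proof.
move=> [mf [fi fe]] [mg [gi ge]]; split; last split.
- by apply: measurable_funD => //; exact: measurable_funM.
- by move=> xs xsd; apply: varm_integrable_linear; [|exact: fi|exact: gi].
- move=> A mA; have [ef efE] := fe _ mA; have [eg egE] := ge _ mA.
  exists (a *: ef + eg) => xs xsd; rewrite sint_linear//; [|exact: fi|exact: gi].
  by rewrite efE// egE// (dualED _ _ xsd) (dualEZ _ _ xsd).
Qed.

Lemma sint_ae xs A f g : dualE xs -> measurable A ->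
  measurable_fun setT f -> measurable_fun setT g ->
  ae (mnullm Sig m) (fun w => f w = g w) ->
  sint Sig m xs A f = sint Sig m xs A g.
Proof.
move=> xsd mA mf mg fg; have [P [N [PE NE _ P0 N0]]] := jordan_measures_null xsd.
rewrite /sint -PE -NE; congr (_ - _)%E; apply: ae_eq_integral => //;
  try (by apply/measurable_EFinP; apply: measurable_funTS).
- by apply: filterS (ae_measure P0 fg) => w /= ->.
- by apply: filterS (ae_measure N0 fg) => w /= ->.
Qed.

Lemma varm_integrable_ae xs f g : dualE xs ->
  measurable_fun setT f -> measurable_fun setT g ->
  ae (mnullm Sig m) (fun w => f w = g w) ->
  (varm Sig m xs).-integrable setT (EFin \o f) ->
  (varm Sig m xs).-integrable setT (EFin \o g).
Proof.
move=> xsd mf mg fg; have [P [N [PE NE <- P0 N0]]] := jordan_measures_null xsd.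
have fV (h : T -> R) : measurable_fun setT h -> measurable_fun setT (EFin \o h).
  by move=> ?; exact/measurable_EFinP.
have gV (Q : {measure set T -> \bar R}) :
    (forall A, mnullm Sig m A -> measurable A /\ Q A = 0%E) ->
    Q.-integrable setT (EFin \o f) -> Q.-integrable setT (EFin \o g).
  move=> Q0 /integrableP[_ fi]; apply/integrableP; split; first exact: fV.
  apply: le_lt_trans fi; rewrite le_eqVlt; apply/orP; left; apply/eqP.
  apply: ge0_ae_eq_integral => //; try by apply: measurableT_comp => //; exact: fV.
  by apply: filterS (ae_measure Q0 fg) => w /= ->.
by move=> /integrable_measure_add[Pf Nf]; apply/integrable_measure_add; split; exact: gV.
Qed.

Lemma L1m_ae f g : L1m Sig m f -> measurable_fun setT g ->
  ae (mnullm Sig m) (fun w => f w = g w) -> L1m Sig m g.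
Proof.
move=> [mf [fi fe]] mg fg; split=> //; split.
  by move=> xs xsd; apply: varm_integrable_ae fg _ => //; exact: fi.
move=> A mA; have [e eE] := fe _ mA; exists e => xs xsd.
by rewrite -eE//; apply/esym/sint_ae.
Qed.

(** The integral of f over A is the difference of the integrals of |f| over the parts of A where f
    >= 0 and f < 0. Membership in [Lpm] speaks only of powers of |f|, so this is the way back to
    f. *)
Lemma L1m_abs (f : T -> R) : measurable_fun setT f ->
  L1m Sig m (fun w => `|f w|) -> L1m Sig m f.
Proof.
move=> mf [maf [fi fe]]; split=> //.
have fi' xs : dualE xs -> (varm Sig m xs).-integrable setT (EFin \o f).
  move=> xsd; have := fi _ xsd; have [P [N [_ _ <- _ _]]] := jordan_measures_null xsd.
  move=> /integrableP[_ h]; apply/integrableP; split; first exact/measurable_EFinP.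
  by under eq_integral do rewrite /= -abse_EFin; under eq_integral do rewrite -abse_id.
split=> // A mA; pose P := [set w | 0 <= f w].
have mP : measurable P.
  by rewrite -[P]setTI; apply: measurable_fun_le => //; exact: measurable_cst.
have mAP : measurable (A `&` P) by exact: measurableI.
have mAN : measurable (A `&` ~` P) by apply: measurableI => //; exact: measurableC.
have [e1 e1E] := fe _ mAP; have [e2 e2E] := fe _ mAN.
exists (e1 - e2) => xs xsd.
have -> : xs (e1 - e2) = xs e1 - xs e2.
  by rewrite (dualED _ _ xsd) -scaleN1r (dualEZ _ _ xsd) mulN1r.
rewrite EFinB -e1E// -e2E//.
have := fi _ xsd; have [Pm [Nm [PE NE <- _ _]]] := jordan_measures_null xsd.
move=> /integrable_measure_add[Pf Nf]; rewrite /sint -PE -NE.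
have split_int (Q : {measure set T -> \bar R}) :
    Q.-integrable setT (EFin \o (fun w => `|f w|)) ->
    (\int[Q]_(w in A) (f w)%:E =
     \int[Q]_(w in A `&` P) `|f w|%:E - \int[Q]_(w in A `&` ~` P) `|f w|%:E)%E.
  move=> Qf; rewrite -{1}(setUIDK A P) integral_setU//.
  - congr (_ + _)%E.
      by apply: eq_integral => w; rewrite inE => -[_ /= f0]; rewrite ger0_norm.
    have Qf' : Q.-integrable (A `&` ~` P) (EFin \o (fun w => `|f w|)).
      exact: integrableS Qf.
    rewrite -[RHS]mul1e -[in RHS]mulN1e.
    rewrite mul1e -integralZl//; apply: eq_integral => w; rewrite inE => -[_ /= /negP].
    by rewrite -ltNge => f0; rewrite ltr0_norm// -EFinM mulN1r opprK.
  - by apply/measurable_EFinP; exact: measurable_funTS.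
  - by apply/disj_setPS => w [[_ ?] [_]].
have sA (Q : {measure set T -> \bar R}) h B : measurable B ->
    Q.-integrable setT h -> Q.-integrable B h by move=> mB; exact: integrableS.
rewrite !split_int//.
rewrite -(fineK (integrable_fin_num mAP (sA _ _ _ mAP Pf))).
rewrite -(fineK (integrable_fin_num mAP (sA _ _ _ mAP Nf))).
rewrite -(fineK (integrable_fin_num mAN (sA _ _ _ mAN Pf))).
rewrite -(fineK (integrable_fin_num mAN (sA _ _ _ mAN Nf))).
by rewrite -!EFinN -!EFinD -?EFinN -?EFinD; congr EFin; ring.
Qed.

(** Functionals separate points, so the choice made by [xget] is forced. *)
Lemma Iint_unique f e : (forall xs, dualE xs -> sint Sig m xs setT f = (xs e)%:E) ->
  Iint Sig m f = e.
Proof.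
move=> h; apply: dual_separates => xs xsd; apply: EFin_inj; rewrite -h//.
have : [set e : E | forall xs, dualE xs -> sint Sig m xs setT f = (xs e)%:E] e by [].
by move=> /(xgetI 0) /(_ _ xsd).
Qed.

Lemma sint_Iint f xs : L1m Sig m f -> dualE xs ->
  sint Sig m xs setT f = (xs (Iint Sig m f))%:E.
Proof.
move=> [_ [_ fe]] xsd; have [e eE] := fe _ measurableT.
by rewrite (Iint_unique eE) eE.
Qed.

Lemma op_on_Iint : op_on (mnullm Sig m) (L1m Sig m) (Iint Sig m).
Proof.
split=> [f g Lf Lg fg|a f g Lf Lg].
  apply: Iint_unique => xs xsd; rewrite -sint_Iint//.
  by apply: sint_ae => //; [exact: Lf.1|exact: Lg.1].
apply: Iint_unique => xs xsd.
rewrite sint_linear//; [|exact: Lf.2.1|exact: Lg.2.1].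
by rewrite !sint_Iint// (dualED _ _ xsd) (dualEZ _ _ xsd).
Qed.

(** Dominated convergence under both Jordan parts, with the limit f itself as the dominating
    function. *)
Lemma order_w_cont_Iint : order_w_cont (mnullm Sig m) (L1m Sig m) (Iint Sig m).
Proof.
move=> fs f Lfs Lf fsf xs xsd.
have [P [N [PE NE VE P0 N0]]] := jordan_measures_null xsd.
have Pf : P.-integrable setT (EFin \o f) /\ N.-integrable setT (EFin \o f).
  by apply/integrable_measure_add; rewrite VE; exact: Lf.2.1.
have Pfs n : P.-integrable setT (EFin \o fs n) /\ N.-integrable setT (EFin \o fs n).
  by apply/integrable_measure_add; rewrite VE; exact: (Lfs n).2.1.
have IE g : L1m Sig m g -> P.-integrable setT (EFin \o g) ->
    N.-integrable setT (EFin \o g) ->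
    xs (Iint Sig m g) = fine (\int[P]_w (g w)%:E) - fine (\int[N]_w (g w)%:E).
  move=> Lg Pg Ng; apply: EFin_inj; rewrite -sint_Iint// /sint -PE -NE EFinB.
  by rewrite !fineK// integrable_fin_num.
have fine_cvg_int (Q : {measure set T -> \bar R}) :
    (forall A, mnullm Sig m A -> measurable A /\ Q A = 0%E) ->
    Q.-integrable setT (EFin \o f) ->
    fine (\int[Q]_w (fs n w)%:E) @[n --> \oo] --> fine (\int[Q]_w (f w)%:E).
  move=> Q0 Qf; have fsfQ := ae_measure Q0 fsf.
  apply: fine_cvg; rewrite fineK; last exact: integrable_fin_num.
  have [//|||||_ _] := @dominated_convergence _ _ _ Q setT measurableT
    (fun n => EFin \o fs n) (EFin \o f) (EFin \o f); last exact.
  - by move=> n; apply/measurable_EFinP; exact: (Lfs n).1.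
  - by apply/measurable_EFinP; exact: Lf.1.
  - apply: filterS fsfQ => w [_ fw] _ /=.
    by apply: cvg_EFin; first exact: nearW.
  - by [].
  - apply: filterS fsfQ => w [fsw fw] n _ /=; rewrite lee_fin.
    have [f0 _] := andP (fsw n); rewrite ger0_norm//.
    rewrite -(cvg_lim _ fw)//; apply: nondecreasing_cvgn_le.
      by apply/nondecreasing_seqP => k; have [] := andP (fsw k).
    by apply/cvg_ex; exists (f w).
rewrite (IE _ Lf Pf.1 Pf.2).
under eq_cvg => n do rewrite (IE _ (Lfs n) (Pfs n).1 (Pfs n).2).
by apply: cvgB; apply: fine_cvg_int => //; [exact: Pf.1|exact: Pf.2].
Qed.

End WeakIntegral.

(** * Operators represented by a vector measure *)

Lemma ae_all {d : measure_display} {T : measurableType d} (N : set T -> Prop) (Q : T -> Prop) :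
  N set0 -> (forall w, Q w) -> ae N Q.
Proof. by move=> N0 Qw; exists set0; split=> // w /=; exact. Qed.

Lemma cvg_indic_bigcup {T : Type} {R : realType} (A : nat -> set T) w :
  (forall n, A n `<=` A n.+1) ->
  (\1_(A n) w : R) @[n --> \oo] --> (\1_(\bigcup_n A n) w : R).
Proof.
move=> Am; have Amn n k : (n <= k)%N -> A n `<=` A k.
  by move=> /subnK <-; elim: (k - n)%N => // j IHj; exact: subset_trans IHj (Am _).
apply: cvg_near_cst; have [[k _ Akw]|Aw] := pselect ((\bigcup_n A n) w).
  exists k => // n /= kn; rewrite !indicE !mem_set//.
    by exists k.
  exact: Amn Akw.
apply: nearW => n; rewrite !indicE !memNset// => Anw; apply: Aw.
by exists n.
Qed.

Import HBNNSimple.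

Section Representation.
Context {d : measure_display} {T : measurableType d} {R : realType}.
Context {E : completeNormedModType R} {Sig : set (set T)} {m : set T -> E}.
Context (SigI : delta_ideal Sig).
Context {X Y : set (T -> R)} {N : set T -> Prop} {S : (T -> R) -> E}.
Context (X0 : X (fun=> 0))
  (Xlin : forall a f g, X f -> X g -> X (fun w => a * f w + g w))
  (SX : forall A, Sig A -> X (\1_A)) (XY : X `<=` Y).
Context (Ym : forall f, Y f -> measurable_fun setT f)
  (YI : forall f A, Y f -> measurable A -> Y (fun w => f w * \1_A w))
  (YZ : forall a f, Y f -> Y (fun w => a * f w)).
Context (N0 : N set0)
  (Slin : forall a f g, Y f -> Y g -> S (fun w => a * f w + g w) = a *: S f + S g)
  (Sw : order_w_cont N Y S) (Sm : forall A, Sig A -> S (\1_A) = m A).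

Let S0 : S (fun=> 0) = 0.
Proof.
have := Slin (-1) (XY X0) (XY X0).
by rewrite scaleN1r addNr => <-; congr S; apply/funext => w; rewrite mulr0 addr0.
Qed.

Let S_indicC f A : Y f -> measurable A ->
  S f = S (fun w => f w * \1_A w) + S (fun w => f w * \1_(~` A) w).
Proof.
move=> Yf mA; rewrite -[X in X + _]scale1r -Slin; [|exact: YI|exact/YI/measurableC].
congr S; apply/funext => w; rewrite mul1r -mulrDr !indicE in_setC.
by case: (w \in A); rewrite ?addr0 ?add0r mulr1.
Qed.

(** Indicators of increasing sets increase to the indicator of the union, so order-w continuity of
    [S] is continuity from below of each scalarization. *)
Lemma representing_weak_vector_measure : weak_vector_measure Sig m.
Proof.
move=> xs xsd; split=> [A B SA SB AB|A SA Am SU].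
  rewrite -!Sm//; last exact: delta_idealU SigI _ _ SA SB.
  rewrite -(dualED _ _ xsd) -[S \1_A]scale1r -Slin; [|exact/XY/SX..].
  congr (xs (S _)); apply/funext => w; rewrite mul1r !indicE in_setU.
  have [wA|_] := boolP (w \in A); have [wB|_] := boolP (w \in B); rewrite ?addr0 ?add0r//.
  by have : (A `&` B) w by [split; exact: set_mem]; rewrite AB.
under eq_cvg do rewrite -Sm//.
rewrite -Sm//; apply: Sw => //; [by move=> n; exact/XY/SX|exact/XY/SX|].
apply: ae_all => // w; split; last exact: cvg_indic_bigcup.
move=> n; rewrite indicE ler0n/= indicE ler_nat.
by have [/set_mem/(Am n)/mem_set ->|] := boolP (w \in A n).
Qed.

Let mM := representing_weak_vector_measure.

Section Positive.
Context {xs : E -> R} (xsd : dualE xs) {P : set T} (mP : measurable P)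
  (Ppos : forall B, Sig B -> B `<=` P -> 0 <= xs (m B))
  (Pneg : forall B, Sig B -> B `<=` ~` P -> xs (m B) <= 0).
Context {Pm : {measure set T -> \bar R}}
  (PmE : Pm = pvar Sig m xs :> (set T -> \bar R)).

(** By [pvar_Hahn], the upper variation of a set B of [Sig] is the value of [xs] at S (\1_(B [&]
    P)); linearity does the rest. Writing simple functions as sums over a list of values permits
    induction on the list. *)
Let simple_integral (r : seq R) (B : R -> set T) :
  (forall y, y \in r -> 0 <= y) -> (forall y, Sig (B y)) ->
  X (fun w => \sum_(y <- r) y * \1_(B y) w) /\
  (\int[Pm]_w (\sum_(y <- r) y * \1_(B y) w)%:E =
   (xs (S (fun w => (\sum_(y <- r) y * \1_(B y) w) * \1_P w)))%:E)%E.
Proof.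
move=> + SB; elim: r => [_|y r IHr r0].
  split.
    by rewrite (_ : (fun _ => _) = fun=> 0)//; apply/funext => w; rewrite big_nil.
  rewrite (_ : (fun _ => _ * _) = fun=> 0).
    rewrite S0 (dualE0 xsd) -[RHS](integral0 Pm setT).
    by apply: eq_integral => w _; rewrite big_nil.
  by apply/funext => w; rewrite big_nil mul0r.
have y0 : 0 <= y by apply: r0; rewrite mem_head.
have r0' z : z \in r -> 0 <= z by move=> zr; apply: r0; rewrite inE zr orbT.
have [Xh hE] := IHr r0'; set h := fun w => \sum_(z <- r) z * \1_(B z) w.
have consE w : \sum_(z <- y :: r) z * \1_(B z) w = y * \1_(B y) w + h w.
  by rewrite big_cons.
have h0 w : 0 <= h w.
  by rewrite /h big_seq; apply: sumr_ge0 => z zr; rewrite mulr_ge0// r0'.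
have mB : measurable (B y) by exact: delta_ideal_measurable SigI _ (SB y).
split.
  rewrite (_ : (fun w => _) = fun w => y * \1_(B y) w + h w).
    exact: Xlin (SX (SB y)) Xh.
  exact/funext.
have SBP := delta_idealI SigI (SB y) mP.
rewrite (_ : (fun w => _ * \1_P w) = fun w => y * \1_(B y `&` P) w + h w * \1_P w).
  rewrite Slin; [|exact/XY/SX|exact/YI/mP/XY].
  rewrite (dualED _ _ xsd) (dualEZ _ _ xsd) EFinD -hE Sm// EFinM.
  rewrite -(pvar_Hahn SigI (mM xsd) mP Ppos Pneg (SB y)) -PmE.
  rewrite -[in RHS](setIT (B y)) -integral_indic//.
  under eq_integral do rewrite consE EFinD EFinM.
  have mBy : measurable_fun setT (fun w => (\1_(B y) w)%:E : \bar R).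
    exact/measurable_EFinP/measurable_indic.
  rewrite ge0_integralD//.
  - by rewrite ge0_integralZl// => w _; rewrite lee_fin.
  - by move=> w _; rewrite -EFinM lee_fin mulr_ge0.
  - by apply/measurable_EFinP; apply: measurable_funM => //; exact: measurable_indic.
  - by move=> w _; rewrite lee_fin.
  - by apply/measurable_EFinP; exact/Ym/XY.
by apply/funext => w; rewrite consE mulrDl -mulrA indicI.
Qed.

(** One increasing sequence of simple functions has two limits, by monotone convergence for the
    integrals and by order-w continuity for the operator. The second is a real number, so the
    integral is finite. *)
Lemma integral_pvar f : Y f -> (forall w, 0 <= f w) ->
  (\int[Pm]_w (f w)%:E = (xs (S (fun w => (f w * \1_P w)%R)))%:E)%E.
Proof.
move=> Yf f0.
have [D [SD DT]] : exists D : nat -> set T, (forall n, Sig (D n)) /\ \bigcup_n D n = setT.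
  by case: SigI.
pose F n := \big[setU/set0]_(i < n) D i.
have SF n : Sig (F n) by exact: delta_ideal_bigsetU SigI _ _ SD.
have mF n : measurable (F n) by exact: delta_ideal_measurable SigI _ (SF n).
have Fm n : F n `<=` F n.+1 by rewrite /F big_ord_recr/=; exact: subsetUl.
have FT : \bigcup_n F n = setT.
  apply/seteqP; split=> // w _; have : (\bigcup_n D n) w by rewrite DT.
  move=> [n _ Dw]; exists n.+1 => //; rewrite /F -bigcup_mkord.
  by exists n => /=.
have mf : measurable_fun setT (EFin \o f) by apply/measurable_EFinP; exact: Ym.
pose s n : T -> R := nnsfun_approx measurableT mf n.
have sm n w : s n w <= s n.+1 w.
  by have := nd_nnsfun_approx measurableT mf (leqnSn n) => /lefP; exact.
have s0 n w : 0 <= s n w by exact: fun_ge0.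
have scvg w : s n w @[n --> \oo] --> f w.
  have := @cvg_nnsfun_approx _ _ _ _ measurableT _ mf _ w Logic.I.
  move=> /(_ _)/fine_cvg; apply=> v _.
  by rewrite lee_fin.
(* Cutting with F n makes every level set a member of [Sig], so that g n lies in X. *)
pose g n w := s n w * \1_(F n) w.
have gE n : exists r B, [/\ forall y, y \in r -> 0 <= y, forall y, Sig (B y) &
    g n = fun w => \sum_(y <- r) y * \1_(B y) w].
  exists (finmap.enum_fset (fset_set (range (s n)))), (fun y => F n `&` s n @^-1` [set y]).
  split.
  - move=> y; rewrite in_fset_set; last exact: fimfunP.
    by rewrite inE => -[w _ <-].
  - by move=> y; apply: (delta_idealI SigI).
  - apply/funext => w; rewrite /g {1}/s fimfunE fsbig_finite/=; last exact: fimfunP.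
    rewrite mulr_suml; apply: eq_bigr => y _.
    by rewrite indicI -mulrA; congr (_ * _); exact: mulrC.
have Xg n : X (g n).
  have [r [B [r0 SB ->]]] := gE n; exact: (simple_integral r0 SB).1.
have intg n : (\int[Pm]_w (g n w)%:E = (xs (S (fun w => (g n w * \1_P w)%R)))%:E)%E.
  have [r [B [r0 SB ->]]] := gE n; exact: (simple_integral r0 SB).2.
have g0 n w : 0 <= g n w by rewrite mulr_ge0.
have gm n w : g n w <= g n.+1 w.
  apply: ler_pM => //; rewrite !indicE ler_nat.
  by have [/set_mem/(Fm n)/mem_set ->|] := boolP (w \in F n).
have gcvg w : g n w @[n --> \oo] --> f w.
  have := @cvg_indic_bigcup T R F w Fm; rewrite FT indicT => h.
  by rewrite -[f w]mulr1; exact: cvgM (scvg w) h.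
have lim1 : (\int[Pm]_w (g n w)%:E)%E @[n --> \oo] --> (\int[Pm]_w (f w)%:E)%E.
  have := @cvg_monotone_convergence _ _ _ Pm _ measurableT (fun n w => (g n w)%:E).
  rewrite (_ : (fun x => limn _) = EFin \o f); last first.
    apply/funext => w; apply: cvg_lim => //.
    by apply: cvg_EFin; [exact: nearW|exact: gcvg].
  apply.
  - by move=> n; apply/measurable_EFinP; exact/Ym/XY.
  - by move=> n w _; rewrite lee_fin.
  - move=> w _; apply/nondecreasing_seqP => n; by rewrite lee_fin.
have lim2 : xs (S (fun w => g n w * \1_P w)) @[n --> \oo] --> xs (S (fun w => f w * \1_P w)).
  apply: Sw => //.
  - by move=> n; apply: YI => //; exact: XY.
  - exact: YI.
  - apply: ae_all => // w; split=> [n|].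
      by rewrite mulr_ge0//= ler_wpM2r.
    by apply: cvgM => //; exact: cvg_cst.
have lim2' : (xs (S (fun w => g n w * \1_P w)))%:E @[n --> \oo] -->
    (xs (S (fun w => f w * \1_P w)))%:E.
  by apply: cvg_EFin; first exact: nearW.
have lim1' : (xs (S (fun w => g n w * \1_P w)))%:E @[n --> \oo] --> (\int[Pm]_w (f w)%:E)%E.
  by under eq_cvg do rewrite -intg.
by rewrite -(cvg_lim _ lim1')// (cvg_lim _ lim2').
Qed.

End Positive.

(** The lower variation is the upper one of -xs, with Hahn set ~[P. Both integrals of f are thus
    finite, and their difference reassembles the restrictions of f to P and ~] P. *)
Let nonneg_representation f xs : Y f -> (forall w, 0 <= f w) -> dualE xs ->
  (varm Sig m xs).-integrable setT (EFin \o f) /\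
  sint Sig m xs setT f = (xs (S f))%:E.
Proof.
move=> Yf f0 xsd; have [Pm [Nm [PE NE VE]]] := jordan_measures SigI (mM xsd).
have [P [mP Ppos Pneg]] := signed_measure_Hahn SigI (mM xsd).
have intP := integral_pvar xsd mP Ppos Pneg PE Yf f0.
have intN : (\int[Nm]_w (f w)%:E = (- xs (S (fun w => (f w * \1_(~` P) w)%R)))%:E)%E.
  apply: (integral_pvar (dualEN xsd) (measurableC mP) _ _ NE Yf f0).
    by move=> B SB BP; rewrite oppr_ge0 Pneg.
  by move=> B SB; rewrite setCK => BP; rewrite oppr_le0 Ppos.
have intf (Q : {measure set T -> \bar R}) r :
    (\int[Q]_w (f w)%:E = r%:E)%E -> Q.-integrable setT (EFin \o f).
  move=> Qr; apply/integrableP; split; first by apply/measurable_EFinP; exact: Ym.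
  rewrite (eq_integral (fun w => (f w)%:E)) ?Qr ?ltry// => w _ /=.
  by rewrite ger0_norm.
rewrite -VE; split.
  by apply/integrable_measure_add; split; [exact: intf intP|exact: intf intN].
rewrite /sint -PE -NE intP intN -EFinN -EFinD opprK -(dualED _ _ xsd).
by rewrite -S_indicC.
Qed.

Let sint_indic xs A f : dualE xs ->
  sint Sig m xs A f = sint Sig m xs setT (fun w => f w * \1_A w).
Proof.
move=> xsd; have [Pm [Nm [PE NE _]]] := jordan_measures SigI (mM xsd).
rewrite /sint -PE -NE; congr (_ - _)%E; rewrite integral_mkcond;
  by apply: eq_integral => w _; rewrite epatch_indic/= EFinM.
Qed.

Let nonneg_L1m f : Y f -> (forall w, 0 <= f w) -> L1m Sig m f.
Proof.
move=> Yf f0; split; first exact: Ym.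
split=> [xs xsd|A mA]; first exact: (nonneg_representation Yf f0 xsd).1.
exists (S (fun w => f w * \1_A w)) => xs xsd; rewrite sint_indic//.
have fA0 w : 0 <= f w * \1_A w by rewrite mulr_ge0.
exact: (nonneg_representation (YI Yf mA) fA0 xsd).2.
Qed.

(** Stability of Y under restriction keeps the positive and negative parts of f in Y, which reduces
    the claim to nonnegative functions. *)
Lemma represented_Iint f : Y f -> L1m Sig m f /\ Iint Sig m f = S f.
Proof.
move=> Yf; pose P := [set w | 0 <= f w].
have mP : measurable P.
  rewrite -[P]setTI; apply: measurable_fun_le => //; exact: Ym.
pose f1 w := f w * \1_P w; pose f2 w := -1 * (f w * \1_(~` P) w).
have Y1 : Y f1 by exact: YI.
have Y2 : Y f2 by apply: YZ; apply: YI => //; exact: measurableC.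
have f10 w : 0 <= f1 w.
  by rewrite /f1 indicE; have [/set_mem//|_] := boolP (w \in P); rewrite ?mulr1 ?mulr0.
have f20 w : 0 <= f2 w.
  rewrite /f2 indicE in_setC mulN1r oppr_ge0.
  have [_|/negP wP] := boolP (w \in P); rewrite ?mulr0// mulr1 ltW// ltNge.
  by apply/negP => f0; apply: wP; exact: mem_set.
have fE : f = fun w => -1 * f2 w + f1 w.
  apply/funext => w; rewrite /f1 /f2 !mulN1r opprK -mulrDr !indicE in_setC.
  by case: (w \in P); rewrite ?addr0 ?add0r mulr1.
have L1 := nonneg_L1m Y1 f10; have L2 := nonneg_L1m Y2 f20.
rewrite fE; split; first exact: (L1m_linear SigI mM).
rewrite (op_on_Iint SigI mM).2// Slin//.
by congr (_ *: _ + _); apply: Iint_unique => xs xsd;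
   [exact: (nonneg_representation Y2 f20 xsd).2|exact: (nonneg_representation Y1 f10 xsd).2].
Qed.

End Representation.

(** * Power factorable operators *)

Section PowerFactorable.
Context {d : measure_display} {T : measurableType d} {R : realType}.
Implicit Types (N : set T -> Prop) (X Y Z : set (T -> R)).

Lemma ifs_measurable N Z f : ifs N Z -> Z f -> measurable_fun setT f.
Proof. by case=> Zm _ _ _ _; exact: Zm. Qed.

Lemma ifs_solid N Z (f g : T -> R) : N set0 -> ifs N Z -> Z f -> measurable_fun setT g ->
  (forall w, `|g w| <= `|f w|) -> Z g.
Proof. by move=> N0 [_ _ _ _ Zsol] Zf mg gf; apply: (Zsol f g) => //; exact: ae_all. Qed.

Lemma ifs_linear N Z a f g : ifs N Z -> Z f -> Z g -> Z (fun w => a * f w + g w).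
Proof. by case=> _ _ ZD ZM _ Zf Zg; exact: ZD (ZM a f Zf) Zg. Qed.

Lemma measurable_abs_powR (f : T -> R) q :
  measurable_fun setT f -> measurable_fun setT (fun w => `|f w| `^ q).
Proof.
move=> mf; apply: (measurableT_comp (measurable_powR q)).
exact: (measurableT_comp (@normr_measurable _ setT)).
Qed.

Lemma ifs_pow_indic N Z q f A : N set0 -> ifs N Z -> 0 < q ->
  ifs_pow q Z f -> measurable A -> ifs_pow q Z (fun w => f w * \1_A w).
Proof.
move=> N0 ZI q0 [mf Zf] mA.
have mfA : measurable_fun setT (fun w => f w * \1_A w).
  by apply: measurable_funM => //; exact: measurable_indic.
split=> //; apply: (ifs_solid N0 ZI Zf) => //; first exact: measurable_abs_powR.
move=> w; rewrite [leLHS]ger0_norm ?powR_ge0// [leRHS]ger0_norm ?powR_ge0//.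
rewrite ge0_ler_powR ?nnegrE//; first exact: ltW.
by rewrite normrM ler_piMr// indicE; case: (w \in A); rewrite ?normr1 ?normr0.
Qed.

Lemma ifs_powZ N Z q a f : ifs N Z -> ifs_pow q Z f ->
  ifs_pow q Z (fun w => a * f w).
Proof.
move=> [_ _ _ ZM _] [mf Zf]; split; first exact: measurable_funM.
rewrite (_ : (fun w => _) = fun w => `|a| `^ q * `|f w| `^ q); first exact: ZM.
by apply/funext => w; rewrite normrM powRM.
Qed.

Lemma ifs_pow0 N Z q : ifs N Z -> 0 < q -> ifs_pow q Z (fun=> 0).
Proof.
move=> [_ Z0 _ _ _] q0; split; first exact: measurable_cst.
rewrite (_ : (fun w => _) = fun=> 0)//.
by apply/funext => w; rewrite normr0 powR0// gt_eqF.
Qed.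

Lemma abs_powRVK (x p : R) : 0 < p -> `| `|x| `^ p | `^ p^-1 = `|x|.
Proof.
by move=> p0; rewrite ger0_norm ?powR_ge0// -powRrM divff ?gt_eqF// powRr1.
Qed.

(** This places |f|^p in the domain of the extended operator, whence its integrability and f in
    L^p. *)
Lemma ifs_pow_abs_powR N Z p f : N set0 -> ifs N Z -> 0 < p -> Z f ->
  ifs_pow p^-1 Z (fun w => `|f w| `^ p).
Proof.
move=> N0 ZI p0 Zf; have mf := ifs_measurable ZI Zf.
split; first exact: measurable_abs_powR.
rewrite (_ : (fun w => _) = fun w => `|f w|).
  apply: (ifs_solid N0 ZI Zf) => //; last by move=> w; rewrite normr_id.
  exact: (measurableT_comp (@normr_measurable _ setT)).
by apply/funext => w; rewrite abs_powRVK.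
Qed.

Lemma mnull0 (mu : {measure set T -> \bar R}) : mnull mu set0.
Proof. by split; [exact: measurable0|exact: measure0]. Qed.

Context {E : completeNormedModType R}.

Lemma delta_ideal_SigmaX N X : N set0 -> ifs N X -> sigma_prop X ->
  delta_ideal (SigmaX X).
Proof.
move=> N0 XI [D [mD [DT XD]]]; split.
- by move=> A [].
- move=> A B [mA XA] mB BA; split=> //; apply: (ifs_solid N0 XI XA).
    exact: measurable_indic.
  move=> w; rewrite !ger0_norm// !indicE ler_nat.
  by have [/set_mem/BA/mem_set ->|] := boolP (w \in B).
- move=> A B [mA XA] [mB XB]; have mAB := measurableU _ _ mA mB; split=> //.
  apply: (ifs_solid N0 XI (ifs_linear 1 XI XA XB)); first exact: measurable_indic.
  move=> w; rewrite mul1r !ger0_norm ?addr_ge0// !indicE in_setU -natrD ler_nat.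
  by case: (w \in A); case: (w \in B).
- by exists D; split.
Qed.

(** Common core of the factorization, where Z is X, and of its optimality, where Z is a competing
    space. The sets and simple functions always come from X; only the domain of the operator
    varies. *)
Lemma pth_fact_representation p N Z S X (m : set T -> E) :
  N set0 -> ifs N Z -> 0 < p -> pth_fact p N Z S ->
  delta_ideal (SigmaX X) -> X (fun=> 0) ->
  (forall a f g, X f -> X g -> X (fun w => a * f w + g w)) -> X `<=` Z ->
  (forall A, SigmaX X A -> S (\1_A) = m A) ->
  weak_vector_measure (SigmaX X) m /\
  (forall f, Z f -> [/\ L1m (SigmaX X) m f, Lpm (SigmaX X) m p f &
                       Iint (SigmaX X) m f = S f]).
Proof.
move=> N0 ZI p0 [_ [St [[_ Stlin] [Stw StS]]]] SigI X0 Xlin XZ Sm.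
have q0 : 0 < p^-1 by rewrite invr_gt0.
have [Zm Z0 _ ZM _] := ZI.
pose W := ifs_sum N (ifs_pow p^-1 Z) Z.
have ZW f : Z f -> W f.
  move=> Zf; split; first exact: Zm.
  exists (fun=> 0), f; split; first exact: ifs_pow0 ZI q0.
  by split=> //; apply: ae_all => // w; rewrite add0r.
have powW f : ifs_pow p^-1 Z f -> W f.
  move=> Zf; split; first exact: Zf.1.
  exists f, (fun=> 0); split=> //.
  by split=> //; apply: ae_all => // w; rewrite addr0.
(* Restricting both summands of a decomposition restricts the sum, outside the same null set. *)
have WI f A : W f -> measurable A -> W (fun w => f w * \1_A w).
  move=> [mf [f1 [f2 [Z1 [Z2 [B [NB fB]]]]]]] mA.
  have mI (g : T -> R) : measurable_fun setT g -> measurable_fun setT (fun w => g w * \1_A w).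
    by move=> mg; apply: measurable_funM => //; exact: measurable_indic.
  split; first exact: mI.
  exists (fun w => f1 w * \1_A w), (fun w => f2 w * \1_A w).
  split; first exact: ifs_pow_indic ZI _ _ _.
  split.
    apply: (ifs_solid N0 ZI Z2); first exact/mI/Zm.
    move=> w; rewrite normrM ler_piMr// indicE.
    by case: (w \in A); rewrite ?normr1 ?normr0.
  exists B; split=> // w /= h; apply: fB => /= fE; apply: h.
  by rewrite fE mulrDl.
have WZ a f : W f -> W (fun w => a * f w).
  move=> [mf [f1 [f2 [Z1 [Z2 [B [NB fB]]]]]]].
  split; first exact: measurable_funM.
  exists (fun w => a * f1 w), (fun w => a * f2 w).
  split; first exact: ifs_powZ ZI _.
  split; first exact: ZM.
  exists B; split=> // w /= h; apply: fB => /= fE; apply: h.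
  by rewrite fE mulrDr.
have XW : X `<=` W by move=> f /XZ/ZW.
have SX A : SigmaX X A -> X (\1_A) by case.
have Wm f : W f -> measurable_fun setT f by case.
have Stm A : SigmaX X A -> St (\1_A) = m A by move=> SA; rewrite StS ?Sm//; exact/XZ/SX.
split; first exact (representing_weak_vector_measure SigI SX XW N0 Stlin Stw Stm).
have rep := represented_Iint SigI X0 Xlin SX XW Wm WI WZ N0 Stlin Stw Stm.
move=> f Zf; have [Lf If] := rep _ (ZW _ Zf).
split=> //; last by rewrite If StS.
split; first exact: Zm.
exact: (rep _ (powW _ (ifs_pow_abs_powR N0 ZI p0 Zf))).1.
Qed.

(** If |f1|^(1/p) is in L^p, its p-th power |f1| is in L^1. So the enlarged domain stays inside
    [L1m], and the integration operator serves as its own extension. *)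
Lemma pth_fact_Iint p Sig (m : set T -> E) : 0 < p -> delta_ideal Sig ->
  weak_vector_measure Sig m ->
  pth_fact p (mnullm Sig m) (Lpm Sig m p `&` L1m Sig m) (Iint Sig m).
Proof.
move=> p0 SigI mM; have [Iae Ilin] := op_on_Iint SigI mM.
split; first by split=> [f g [_ Lf] [_ Lg]|a f g [_ Lf] [_ Lg]]; [exact: Iae|exact: Ilin].
set W := ifs_sum _ _ _.
have WL f : W f -> L1m Sig m f.
  move=> [mf [f1 [f2 [[m1 [[_ L1] _]] [[_ L2] f12]]]]].
  have {}L1 : L1m Sig m f1.
    apply: (L1m_abs SigI mM) => //.
    rewrite (_ : (fun w => _) = fun w => `| `|f1 w| `^ p^-1 | `^ p)//.
    by apply/funext => w; rewrite -{2}(invrK p) abs_powRVK// invr_gt0.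
  apply: (L1m_ae SigI mM (L1m_linear SigI mM 1 L1 L2)) => //.
  case: f12 => B [NB fB]; exists B; split=> // w /= h; apply: fB => /= fE; apply: h.
  by rewrite fE mul1r.
exists (Iint Sig m); split; last split=> //.
  by split=> [f g /WL Lf /WL Lg|a f g /WL Lf /WL Lg]; [exact: Iae|exact: Ilin].
move=> fs f Wfs /WL Lf; apply: (order_w_cont_Iint SigI mM) => // n.
exact: WL.
Qed.

End PowerFactorable.

(** * The factorization theorem and its optimality *)

Unset Implicit Arguments.

Theorem theorem4p2 (d : measure_display) (T : measurableType d) (R : realType)
  (mu : {measure set T -> \bar R}) (X : set (T -> R))
  (E : completeNormedModType R) (p : R) (Top : (T -> R) -> E) :
  ifs (mnull mu) X -> sigma_prop X -> 0 < p ->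
  pth_fact p (mnull mu) X Top ->
  let m := mT Top in
  let Sig := SigmaX X in
  let Nm := mnullm Sig m in
  let LpL1 := Lpm Sig m p `&` L1m Sig m in
  [/\ incl_wd (mnull mu) Nm X LpL1,
      (forall f, X f -> Top f = Iint Sig m f),
      pth_fact p Nm LpL1 (Iint Sig m) &
      forall (xi : {measure set T -> \bar R}) (Z : set (T -> R))
             (S : (T -> R) -> E),
        abs_cont (mnull xi) (mnull mu) ->
        ifs (mnull xi) Z ->
        incl_wd (mnull mu) (mnull xi) X Z ->
        pth_fact p (mnull xi) Z S ->
        (forall f, X f -> Top f = S f) ->
        incl_wd (mnull xi) Nm Z LpL1 /\
        (forall f, Z f -> S f = Iint Sig m f)].
Proof.
move=> XI Xsig p0 Tfact m Sig Nm LpL1.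
have N0 := mnull0 mu; have [Xm X0 _ _ _] := XI.
have SigI : delta_ideal Sig by exact: delta_ideal_SigmaX N0 XI Xsig.
have Xlin a f g : X f -> X g -> X (fun w => a * f w + g w) by exact: ifs_linear XI.
have [mM rep] := @pth_fact_representation _ _ _ _ p _ X Top X m N0 XI p0 Tfact SigI X0
  Xlin (fun f Xf => Xf) (fun A _ => erefl).
split.
- split; last by move=> f Xf; have [? ? _] := rep f Xf; split.
  (* For B inside a mu-null set, \1_B vanishes almost everywhere, hence m B = Top 0 = 0. *)
  move=> A [mA A0]; apply/(mnullmP SigI mM); split=> // B [mB XB] BA.
  have [Iae _] := op_on_Iint SigI mM.
  have [[Tae Tlin] _] := Tfact.
  have T0 : Top (fun=> 0) = 0.
    have := Tlin (-1) _ _ X0 X0; rewrite scaleN1r addNr => <-.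
    by congr Top; apply/funext => w; rewrite mulr0 addr0.
  rewrite /m /mT -T0; apply: Tae => //; exists A; split=> // w /= h.
  apply: contrapT => Aw; apply: h; rewrite indicE memNset// => Bw.
  exact/Aw/BA.
- by move=> f Xf; have [_ _ ->] := rep f Xf.
- exact: pth_fact_Iint.
move=> xi Z S ximu ZI [_ XZ] Sfact TS.
have Nx0 := mnull0 xi; have [_ Z0 _ _ _] := ZI.
(* As S agrees with Top on X, it represents the same measure [m] on [SigmaX X]. *)
have [_ repZ] := @pth_fact_representation _ _ _ _ p _ Z S X m Nx0 ZI p0 Sfact SigI X0
  Xlin XZ (fun A SA => esym (TS _ SA.2)).
split; last by move=> f Zf; have [_ _ ->] := repZ f Zf.
split; last by move=> f Zf; have [? ? _] := repZ f Zf; split.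
(* The same argument for xi-null sets, with m B rewritten as the value of S at \1_B. *)
move=> A [mA A0]; apply/(mnullmP SigI mM); split=> // B [mB XB] BA.
have [[Sae Slin] _] := Sfact.
have S0 : S (fun=> 0) = 0.
  have := Slin (-1) _ _ Z0 Z0; rewrite scaleN1r addNr => <-.
  by congr S; apply/funext => w; rewrite mulr0 addr0.
rewrite /m /mT TS// -S0; apply: Sae => //; first exact: XZ.
exists A; split=> // w /= h.
apply: contrapT => Aw; apply: h; rewrite indicE memNset// => Bw.
exact/Aw/BA.
Qed.
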